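(* Let $0<\rho<1$. Let $\xi_\pm=1+\rho\pm\sqrt{1+\rho^2}$ and $g(i)=-\dfrac{\xi_+^i-\xi_-^i}{\xi_+-\xi_-}$ for $i\in\mathbb N$. The invariant distribution $\pi$ of the symmetric infinite-capacity join-the-shortest-queue process satisfies $$\pi(j,k)=\sum_{l=k}^{2k-1}\pi(0,l)\cdot\left(g^{\ast(l-k+1)}(j)-g^{\ast(l-k+1)}(j+1)\right)\qquad\text{for }0\le j<k,$$ $$\pi(k,k)=-\frac1\rho\sum_{l=k+1}^{2k+1}\pi(0,l)\,g^{\ast(l-k)}(k+1)\qquad\text{for }k\in\mathbb N.$$
   Context: $\mathbb N=\{0,1,2,\dots\}$. For $\varphi,\psi:\mathbb N\to\mathbb C$, $(\varphi\ast\psi)(n)=\sum_{m=0}^n\varphi(m)\psi(n-m)$, and for $k\ge1$, $\varphi^{\ast k}$ is the $k$-fold convolution of $\varphi$ with itself ($\varphi^{\ast1}=\varphi$). Symmetric infinite-capacity JSQ model: two one-server queues with infinite capacity, exponential service times with parameter $1$ at both queues, Poisson arrivals with parameter $2\rho$; arriving customers join the shortest queue, or either queue with probability $1/2$ if both lengths are equal. The queue-length process is the continuous-time Markov chain on $\mathbb N^2$ with rates: from $(k,k)$, to $(k+1,k)$ and $(k,k+1)$ at rate $\rho$ each, and to $(k-1,k)$ and $(k,k-1)$ at rate $1$ each if $k>0$; from $(j,k)$ with $j<k$, to $(j+1,k)$ at rate $2\rho$, to $(j-1,k)$ at rate $1$ if $j>0$, to $(j,k-1)$ at rate $1$; and symmetrically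 from $(k,j)$ with $j<k$, to $(k,j+1)$ at rate $2\rho$, to $(k,j-1)$ at rate $1$ if $j>0$, to $(k-1,j)$ at rate $1$. For $\rho<1$ it is ergodic, and $\pi$ denotes its unique invariant probability distribution; $\pi(j,k)=\pi(k,j)$. *)

(* Defs.v *)
From HB Require Import structures.
From mathcomp Require Import all_boot all_order all_algebra.
From mathcomp Require Import all_classical all_reals all_analysis.

Set Implicit Arguments.
Unset Strict Implicit.
Unset Printing Implicit Defensive.

Import Order.TTheory GRing.Theory Num.Theory.

Local Open Scope classical_set_scope.
Local Open Scope ring_scope.

Definition conv (R : pzSemiRingType) (phi psi : nat -> R) (n : nat) : R :=
  \sum_(m < n.+1) phi m * psi (n - m)%N.

(* [convn phi 1] is [phi] itself; the value at [k = 0] is the unit of [conv]. *)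
Definition convn (R : pzSemiRingType) (phi : nat -> R) (k : nat) : nat -> R :=
  iterop k (@conv R) phi (fun n => (n == 0%N)%:R).

(* [q x y] is the jump rate from [x] to [y], for [x != y].  Invariance is
   [p Q = 0] for the Q-matrix [Q] with off-diagonal entries [q] and zero row
   sums, the diagonal term being moved to the right-hand side so that all sums
   have nonnegative terms.  For bounded rates (the only case used below) this
   is invariance under the transition semigroup of the chain. *)
Definition invariant_distribution (R : realType) (T : choiceType)
    (q : T -> T -> R) (p : T -> R) : Prop :=
  [/\ forall x, 0 <= p x,
      (\esum_(x in [set: T]) (p x)%:E = 1)%E &
      forall y, (\esum_(x in [set x | x != y]) (p x * q x y)%:E =
                 (p y)%:E * \esum_(z in [set z | z != y]) (q y z)%:E)%E ].

Definition jsq_rate (R : realType) (rho : R) (x y : nat * nat) : R :=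
  let: (j, k) := x in
  if y == (j.+1, k) then
    if j == k then rho else if (j < k)%N then 2 * rho else 0
  else if y == (j, k.+1) then
    if j == k then rho else if (k < j)%N then 2 * rho else 0
  else if (0 < j)%N && (y == (j.-1, k)) then 1
  else if (0 < k)%N && (y == (j, k.-1)) then 1
  else 0.

Definition xi_plus (R : realType) (rho : R) : R :=
  1 + rho + Num.sqrt (1 + rho ^+ 2).

Definition xi_minus (R : realType) (rho : R) : R :=
  1 + rho - Num.sqrt (1 + rho ^+ 2).

Definition jsq_g (R : realType) (rho : R) (i : nat) : R :=
  - ((xi_plus rho ^+ i - xi_minus rho ^+ i) / (xi_plus rho - xi_minus rho)).

(* Main.v *)
(* Above the diagonal the balance equations can be solved forward in [j]: they
   express [pi(j+1, k)] by [pi(j, k)], [pi(j-1, k)] and [pi(j, k+1)], so that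
   [pi(j, k)] is a combination of the [pi(0, l)] with [l >= k].  The generating
   function [G(z) = - z / (1 - 2 (1 + rho) z + 2 rho z^2)] of [g] turns this
   recursion into a recursion between convolution powers of [g].
   On the diagonal, balancing the flow across the boundary of the square
   [{max(j,k) <= n}] gives [2 rho pi(n, n) = sum_(j <= n) (pi(j, n+1) +
   pi(n+1, j))], and the sum telescopes once [pi] is known to be symmetric.
   Symmetry: [d(j, k) = pi(j, k) - pi(k, j)] satisfies the balance equations of
   the chain killed on the diagonal, so the column sums [C_k] of [|d|] are
   nondecreasing in [k]; by the cut equation they are at most
   [2 rho pi(k, k)], which is summable, hence they vanish. *)
Require Import Defs.
From HB Require Import structures.
From mathcomp Require Import all_boot all_order all_algebra.
From mathcomp Require Import all_classical all_reals all_analysis.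
From mathcomp Require Import zify ring lra.

Set Implicit Arguments.
Unset Strict Implicit.
Unset Printing Implicit Defensive.

Import Order.TTheory GRing.Theory Num.Theory.

Local Open Scope ring_scope.

(** * Sums over the countable state space *)

Lemma sum_le_esum (R : realType) (T : choiceType) (f : T -> R) (s : seq T) :
  uniq s ->
  ((\sum_(x <- s) f x)%:E <= \esum_(x in [set: T]) (f x)%:E)%E.
Proof.
move=> us; apply: esum_ge; exists [set` s]%classic.
  by split => //; exact: finite_seq.
by rewrite -fsbig_seq// sumEFin.
Qed.

Lemma esum_seq (R : realType) (T : choiceType) (A : set T) (f : T -> R)
    (s : seq T) :
  uniq s -> (forall x, x \in s -> A x) ->
  (forall x, 0 <= f x) -> (forall x, x \notin s -> f x = 0) ->
  (\esum_(x in A) (f x)%:E = (\sum_(x <- s) f x)%:E)%E.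
Proof.
move=> us sA f0 fs0; rewrite (esumID [set` s]%classic); last first.
  by move=> x _; rewrite lee_fin.
rewrite [X in (_ + X)%E]esum1 ?adde0; last first.
  by move=> x [_ /= /negP xs]; rewrite fs0.
have -> : (A `&` [set` s] = [set` s])%classic.
  by apply/seteqP; split => x /=; [case|move=> xs; split => //; exact: sA].
rewrite esum_fset; [|exact: finite_seq|by move=> x _; rewrite lee_fin].
by rewrite -fsbig_seq// sumEFin.
Qed.

(** * Transition rates and pointwise balance *)

Definition arrival_rate (R : realType) (rho : R) (j k : nat) : R :=
  if j == k then rho else if (j < k)%N then 2 * rho else 0.

(** Sources and targets of jumps alike. The guards are needed since [0.-1 = 0] would put [(j, k)]
    itself in the list. *)
Definition neighbours (j k : nat) : seq (nat * nat) :=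
  [:: (j.+1, k); (j, k.+1)] ++
  (if (0 < j)%N then [:: (j.-1, k)] else [::]) ++
  (if (0 < k)%N then [:: (j, k.-1)] else [::]).

Lemma neighbours_uniq (j k : nat) : uniq (neighbours j k).
Proof.
by case: j => [|j]; case: k => [|k]; rewrite /= ?inE ?xpair_eqE //; lia.
Qed.

Lemma neighbours_neq (j k : nat) (x : nat * nat) :
  x \in neighbours j k -> x != (j, k).
Proof.
case: x => a b.
by case: j => [|j]; case: k => [|k]; rewrite /= !inE !xpair_eqE; lia.
Qed.

Lemma sum_neighbours (R : realType) (F : nat * nat -> R) (j k : nat) :
  \sum_(x <- neighbours j k) F x =
  F (j.+1, k) + F (j, k.+1) + (0 < j)%:R * F (j.-1, k)
  + (0 < k)%:R * F (j, k.-1).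
Proof.
rewrite !big_cat /= !big_cons big_nil.
by case: j => [|j]; case: k => [|k];
  rewrite /= ?big_cons ?big_nil; ring.
Qed.

Lemma jsq_rate_in0 (R : realType) (rho : R) (j k : nat) (x : nat * nat) :
  x \notin neighbours j k -> jsq_rate rho x (j, k) = 0.
Proof.
case: x => a b; case: j => [|j]; case: k => [|k];
  rewrite /jsq_rate /= !inE !xpair_eqE => nx;
  by do ![case: ifP => ?] => //; exfalso; lia.
Qed.

Lemma jsq_rate_out0 (R : realType) (rho : R) (j k : nat) (x : nat * nat) :
  x \notin neighbours j k -> jsq_rate rho (j, k) x = 0.
Proof.
case: x => a b; case: j => [|j]; case: k => [|k];
  rewrite /jsq_rate /= !inE !xpair_eqE => nx;
  by do ![case: ifP => ?] => //; exfalso; lia.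
Qed.

Lemma jsq_rate_ge0 (R : realType) (rho : R) (x y : nat * nat) :
  0 <= rho -> 0 <= jsq_rate rho x y.
Proof.
move=> r0; have r2 : 0 <= 2 * rho by lra.
by case: x => a b; rewrite /jsq_rate /=; do ![case: ifP => _].
Qed.

Lemma jsq_rate_arrival1 (R : realType) (rho : R) (j k : nat) :
  jsq_rate rho (j, k) (j.+1, k) = arrival_rate rho j k.
Proof. by rewrite /jsq_rate eqxx. Qed.

Lemma jsq_rate_arrival2 (R : realType) (rho : R) (j k : nat) :
  jsq_rate rho (j, k) (j, k.+1) = arrival_rate rho k j.
Proof.
rewrite /jsq_rate /arrival_rate /= !xpair_eqE.
by do ![case: ifP => ?] => //; exfalso; lia.
Qed.

Lemma jsq_rate_service1 (R : realType) (rho : R) (j k : nat) :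
  jsq_rate rho (j.+1, k) (j, k) = 1.
Proof.
rewrite /jsq_rate /= !xpair_eqE.
by do ![case: ifP => ?] => //; exfalso; lia.
Qed.

Lemma jsq_rate_service2 (R : realType) (rho : R) (j k : nat) :
  jsq_rate rho (j, k.+1) (j, k) = 1.
Proof.
rewrite /jsq_rate /= !xpair_eqE.
by do ![case: ifP => ?] => //; exfalso; lia.
Qed.

Lemma jsq_balance (R : realType) (rho : R) (p : nat * nat -> R) (j k : nat) :
  0 <= rho -> invariant_distribution (jsq_rate rho) p ->
  p (j, k) * (arrival_rate rho j k + arrival_rate rho k j
              + (0 < j)%:R + (0 < k)%:R) =
  p (j.+1, k) + p (j, k.+1)
  + (0 < j)%:R * (arrival_rate rho j.-1 k * p (j.-1, k))
  + (0 < k)%:R * (arrival_rate rho k.-1 j * p (j, k.-1)).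
Proof.
move=> r0 [p0 _ /(_ (j, k))].
rewrite (@esum_seq _ _ _ _ (neighbours j k)).
- rewrite (@esum_seq _ _ _ _ (neighbours j k)).
  + rewrite -EFinM => /eqP; rewrite eqe => /eqP.
    rewrite !sum_neighbours !jsq_rate_arrival1 !jsq_rate_arrival2.
    rewrite jsq_rate_service1 jsq_rate_service2.
    case: j => [|j]; case: k => [|k];
      rewrite ?ltnn ?ltn0Sn ?mulr0n ?mulr1n ?mul0r ?mul1r
        ?(succnK, jsq_rate_arrival1, jsq_rate_arrival2, jsq_rate_service1,
          jsq_rate_service2); lra.
  + exact: neighbours_uniq.
  + exact: neighbours_neq.
  + by move=> x; rewrite mulr_ge0 ?jsq_rate_ge0.
  + by move=> x nx; rewrite jsq_rate_in0 ?mulr0.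
- exact: neighbours_uniq.
- exact: neighbours_neq.
- by move=> x; exact: jsq_rate_ge0.
- exact: jsq_rate_out0.
Qed.

(** * Balance equations, column sums and the cut *)

Definition balanced (R : realType) (rho : R) (u : nat -> nat -> R) : Prop :=
  forall j k : nat,
    u j k * (arrival_rate rho j k + arrival_rate rho k j
             + (0 < j)%:R + (0 < k)%:R) =
    u j.+1 k + u j k.+1
    + (0 < j)%:R * (arrival_rate rho j.-1 k * u j.-1 k)
    + (0 < k)%:R * (arrival_rate rho k.-1 j * u j k.-1).

Lemma balanced_swap (R : realType) (rho : R) (u : nat -> nat -> R) :
  balanced rho u -> balanced rho (fun j k => u k j).
Proof. by move=> bu j k; move: (bu k j) => /=; lra. Qed.

(** For [j < k] arrivals raise only [j]. An arrival entering from [(j, k.-1)] needs [k.-1 <= j], so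
    it starts on the diagonal. *)
Lemma balanced_upper (R : realType) (rho : R) (u : nat -> nat -> R)
    (j k : nat) :
  balanced rho u -> (j < k)%N ->
  (2 * rho + 1 + (0 < j)%:R) * u j k =
  (0 < j)%:R * (2 * rho * u j.-1 k) + u j.+1 k + u j k.+1
  + (j.+1 == k)%:R * (rho * u j j).
Proof.
move=> bu; case: k => // k jk.
have a1 : arrival_rate rho j k.+1 = 2 * rho.
  by rewrite /arrival_rate; do ![case: ifP => ?] => //; exfalso; lia.
have a2 : arrival_rate rho k.+1 j = 0.
  by rewrite /arrival_rate; do ![case: ifP => ?] => //; exfalso; lia.
have a3 : arrival_rate rho j.-1 k.+1 = 2 * rho.
  by rewrite /arrival_rate; do ![case: ifP => ?] => //; exfalso; lia.
have a4 : arrival_rate rho k j * u j k = (j.+1 == k.+1)%:R * (rho * u j j).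
  rewrite eqSS /arrival_rate eq_sym; case: eqP => [->|jk'].
    by rewrite mul1r.
  by rewrite ltnNge -ltnS jk !mul0r.
move: (bu j k.+1); rewrite a1 a2 a3 succnK a4 ltn0Sn mulr1n; lra.
Qed.

Lemma balanced_diag0 (R : realType) (rho : R) (u : nat -> nat -> R) :
  balanced rho u -> 2 * rho * u 0%N 0%N = u 1%N 0%N + u 0%N 1%N.
Proof. by move=> /(_ 0%N 0%N); rewrite /arrival_rate ltnn /=; lra. Qed.

Lemma balanced_diagS (R : realType) (rho : R) (u : nat -> nat -> R) (k : nat) :
  balanced rho u ->
  (2 * rho + 2) * u k.+1 k.+1 =
  2 * rho * (u k k.+1 + u k.+1 k) + u k.+2 k.+1 + u k.+1 k.+2.
Proof.
have a1 : arrival_rate rho k.+1 k.+1 = rho by rewrite /arrival_rate eqxx.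
have a2 : arrival_rate rho k k.+1 = 2 * rho.
  by rewrite /arrival_rate; do ![case: ifP => ?] => //; exfalso; lia.
by move=> /(_ k.+1 k.+1); rewrite a1 succnK a2 ltn0Sn mulr1n; lra.
Qed.

(** Arrivals and services at the shorter queue telescope; the remaining sum is service at the longer
    one. An arbitrary [v] covers both [u] and [|d|]. *)
Lemma sum_column (R : comPzRingType) (rho : R) (v : nat -> R) (n : nat) :
  \sum_(j < n.+1) ((2 * rho + 1 + (0 < j)%:R) * v j
                   - (0 < j)%:R * (2 * rho * v j.-1) - v j.+1) =
  \sum_(j < n.+1) v j + 2 * rho * v n - v n.+1.
Proof.
elim: n => [|n IHn].
  by rewrite !big_ord_recr !big_ord0 /=; ring.
by rewrite big_ord_recr IHn [in RHS]big_ord_recr /=; ring.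
Qed.

Lemma balanced_column (R : realType) (rho : R) (u : nat -> nat -> R) (k : nat) :
  balanced rho u ->
  \sum_(j < k.+1) u j k.+1 + 2 * rho * u k k.+1 =
  u k.+1 k.+1 + \sum_(j < k.+1) u j k.+2 + rho * u k k.
Proof.
move=> bu; have := sum_column rho (u ^~ k.+1) k.
rewrite (eq_bigr (fun j : 'I_k.+1 =>
    u j k.+2 + (j.+1 == k.+1)%:R * (rho * u j j))); last first.
  by move=> j _; rewrite (balanced_upper bu (ltn_ord j)); lra.
rewrite big_split /= [X in _ + X = _]big_ord_recr /=.
rewrite [X in _ + (X + _) = _]big1 => [|j _]; last first.
  by rewrite eqSS ltn_eqF ?ltn_ord ?mul0r.
rewrite eqxx mulr1n; lra.
Qed.

(* The two sides are the stationary flows across the boundary of the square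
   [{max(j,k) <= n}]: arrivals leave it only through the corner [(n, n)]. *)
Lemma balanced_cut (R : realType) (rho : R) (u : nat -> nat -> R) (n : nat) :
  balanced rho u ->
  \sum_(j < n.+1) (u j n.+1 + u n.+1 j) = 2 * rho * u n n.
Proof.
move=> bu; elim: n => [|n].
  by rewrite big_ord_recr big_ord0 /= (balanced_diag0 bu) add0r addrC.
(* Adding the balances of column [n.+1], row [n.+1] and the corner moves the cut from [n] to
   [n.+1]. *)
have c1 := balanced_column n bu.
have c2 := balanced_column n (balanced_swap bu).
have := balanced_diagS n bu.
rewrite !big_split [in X in _ -> _ -> X]big_ord_recr.
rewrite [X in _ -> _ -> _ + X = _]big_ord_recr /=.
move: c1 c2 => /=; lra.
Qed.

(** * Symmetry under exchange of the queues *)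

Lemma balanced_sym (R : realType) (rho : R) (u : nat -> nat -> R) (B : R) :
  0 <= rho -> balanced rho u -> (forall j k, 0 <= u j k) ->
  (forall k n : nat, \sum_(k <= i < n) u i i <= B) ->
  forall j k, u j k = u k j.
Proof.
move=> r0 bu u0 uB.
pose d j k := u j k - u k j.
pose C k := \sum_(j < k.+1) `|d j k.+1|.
have C_incr k : C k <= C k.+1.
  have := sum_column rho (fun j => `|d j k.+1|) k.
  rewrite [d k.+1 k.+1]subrr normr0 subr0 => eC.
  have dk : \sum_(j < k.+1) ((2 * rho + 1 + (0 < j)%:R) * `|d j k.+1|
      - (0 < j)%:R * (2 * rho * `|d j.-1 k.+1|) - `|d j.+1 k.+1|)
      <= \sum_(j < k.+1) `|d j k.+2|.
    apply: ler_sum => j _; rewrite !lerBlDr.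
    have c0 : 0 <= 2 * rho + 1 + (0 < j)%:R :> R.
      by rewrite !addr_ge0 ?mulr_ge0 ?ler0n.
    have c1 : 0 <= (0 < j)%:R * (2 * rho) :> R by rewrite !mulr_ge0 ?ler0n.
    rewrite -[X in X * `|_|](ger0_norm c0) mulrA.
    rewrite -[X in _ <= _ + X * `|_|](ger0_norm c1) -!normrM.
    (* The diagonal source [rho * u j j] is common to [u] and its mirror image, so it cancels in
       [d]. *)
    have -> : (2 * rho + 1 + (0 < j)%:R) * d j k.+1 =
        d j k.+2 + d j.+1 k.+1 + (0 < j)%:R * (2 * rho) * d j.-1 k.+1.
      rewrite /d mulrBr (balanced_upper bu (ltn_ord j)).
      by rewrite (balanced_upper (balanced_swap bu) (ltn_ord j)); ring.
    by rewrite (le_trans (ler_normD _ _))// lerD2r ler_normD.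
  rewrite /C [leRHS]big_ord_recr /=.
  have d1 : 0 <= rho * `|d k k.+1| by rewrite mulr_ge0.
  have d2 : 0 <= `|d k.+1 k.+2| by [].
  move: eC dk d1 d2; lra.
have C_le k : C k <= 2 * rho * u k k.
  rewrite -(balanced_cut k bu); apply: ler_sum => j _.
  by rewrite (le_trans (ler_normB _ _))// !ger0_norm.
have C0 k : C k <= 0.
  (* By monotonicity [n] copies of [C k] fit below [n] consecutive diagonal terms, whose sum is
     bounded uniformly in [n]; the Archimedean property then excludes [C k > 0]. *)
  have CN n : n%:R * C k <= 2 * rho * B.
    have : \sum_(k <= i < k + n) C k <= \sum_(k <= i < k + n) 2 * rho * u i i.
      rewrite !big_nat; apply: ler_sum => i /andP[ki _].
      rewrite (le_trans _ (C_le i))//.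
      by exact: (homo_leq lexx le_trans C_incr).
    rewrite -mulr_sumr sumr_const_nat addKn -[C k *+ n]mulr_natl => /le_trans; apply.
    by rewrite ler_wpM2l ?mulr_ge0.
  rewrite leNgt; apply/negP => Ck.
  have rB : 0 <= 2 * rho * B by have := CN 0%N; rewrite mul0r.
  have := archi_boundP (divr_ge0 rB (ltW Ck)).
  by rewrite ltr_pdivrMr// ltNge CN.
have d0 j k : (j < k)%N -> u j k = u k j.
  case: k => // k jk; apply/eqP; rewrite -subr_eq0 -normr_le0.
  rewrite (le_trans _ (C0 k))// /C (bigD1 (Ordinal jk))//= lerDl sumr_ge0//.
by move=> j k; case: (ltngtP j k) => [/d0| /d0 ->|->].
Qed.

(** * Convolution powers of [g] *)

Lemma conv0 (R : pzSemiRingType) (phi psi : nat -> R) :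
  phi 0%N = 0 -> Defs.conv phi psi 0 = 0.
Proof. by move=> phi0; rewrite /Defs.conv big_ord1 phi0 mul0r. Qed.

Lemma convS (R : pzSemiRingType) (phi psi : nat -> R) (n : nat) :
  phi 0%N = 0 -> Defs.conv phi psi n.+1 = Defs.conv (fun i => phi i.+1) psi n.
Proof. by move=> phi0; rewrite /Defs.conv big_ord_recl phi0 mul0r add0r. Qed.

(** [iterop] makes the first power [phi] itself, so only [m = 0] needs an argument: the unit law. *)
Lemma convnS (R : pzSemiRingType) (phi : nat -> R) (m n : nat) :
  convn phi m.+1 n = Defs.conv phi (convn phi m) n.
Proof.
case: m => [|m] //.
rewrite /Defs.convn /= /Defs.conv big_ord_recr /= subnn eqxx mulr1 big1 ?add0r//.
by move=> i _; rewrite subn_eq0 leqNgt ltn_ord mulr0.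
Qed.

Lemma jsq_g0 (R : realType) (rho : R) : jsq_g rho 0 = 0.
Proof. by rewrite /jsq_g !expr0 subrr mul0r oppr0. Qed.

Lemma jsq_g1 (R : realType) (rho : R) : jsq_g rho 1 = -1.
Proof.
rewrite /jsq_g !expr1 divff//.
have -> : xi_plus rho - xi_minus rho = 2 * Num.sqrt (1 + rho ^+ 2).
  by rewrite /xi_plus /xi_minus; ring.
by rewrite mulf_neq0 ?pnatr_eq0// gt_eqF// sqrtr_gt0 ltr_pwDl// sqr_ge0.
Qed.

Lemma jsq_gSS (R : realType) (rho : R) (i : nat) :
  jsq_g rho i.+2 = 2 * (1 + rho) * jsq_g rho i.+1 - 2 * rho * jsq_g rho i.
Proof.
have s2 : Num.sqrt (1 + rho ^+ 2) ^+ 2 = 1 + rho ^+ 2.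
  by rewrite sqr_sqrtr// addr_ge0// sqr_ge0.
(* [xi_plus] and [xi_minus] are the roots of the characteristic polynomial of the recursion. *)
have xp : xi_plus rho ^+ 2 = 2 * (1 + rho) * xi_plus rho - 2 * rho.
  by rewrite /xi_plus; ring: s2.
have xm : xi_minus rho ^+ 2 = 2 * (1 + rho) * xi_minus rho - 2 * rho.
  by rewrite /xi_minus; ring: s2.
rewrite /jsq_g -(addn2 i) -(addn1 i) !exprD xp xm !expr1; ring.
Qed.

Lemma convn_jsq_g0 (R : realType) (rho : R) (m : nat) :
  convn (jsq_g rho) m.+1 0 = 0.
Proof. by rewrite convnS (conv0 _ (jsq_g0 rho)). Qed.

Lemma convn_jsq_g1 (R : realType) (rho : R) (m : nat) :
  convn (jsq_g rho) m.+1 1 = - convn (jsq_g rho) m 0.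
Proof.
by rewrite convnS (convS _ _ (jsq_g0 rho)) /Defs.conv big_ord1 jsq_g1 mulN1r.
Qed.

(** Coefficientwise form of [(1 - 2 (1 + rho) z + 2 rho z^2) G^(m+1) = - z G^m]. *)
Lemma convn_jsq_gSS (R : realType) (rho : R) (m i : nat) :
  convn (jsq_g rho) m.+1 i.+2 =
  2 * (1 + rho) * convn (jsq_g rho) m.+1 i.+1
  - 2 * rho * convn (jsq_g rho) m.+1 i - convn (jsq_g rho) m i.+1.
Proof.
rewrite !convnS !(convS _ _ (jsq_g0 rho)) /Defs.conv big_ord_recl jsq_g1 subn0.
under eq_bigr do rewrite lift0 /= jsq_gSS mulrBl -!mulrA subSS.
rewrite sumrB -!mulr_sumr.
by rewrite mulrA; ring.
Qed.

(* The increments [c_m(j) - c_m(j+1)] of the convolution powers are, up to the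
   shift [l -> m = l - k + 1], the coefficients of the solution of the balance
   equations above the diagonal, solved forward in [j]. *)
Lemma balanced_solution (R : realType) (rho : R) (u : nat -> nat -> R)
    (j k M : nat) :
  balanced rho u -> (j < k)%N -> (j < M)%N ->
  u j k = \sum_(m < M) u 0%N (k + m)%N *
            (convn (jsq_g rho) m.+1 j - convn (jsq_g rho) m.+1 j.+1).
Proof.
move=> bu.
have base k' M' : u 0%N k' = \sum_(m < M'.+1) u 0%N (k' + m)%N *
    (convn (jsq_g rho) m.+1 0 - convn (jsq_g rho) m.+1 1).
  rewrite big_ord_recl big1 => [|i _]; last first.
    by rewrite lift0 convn_jsq_g1 !convn_jsq_g0 oppr0 subr0 mulr0.
  by rewrite convn_jsq_g1 convn_jsq_g0 /convn /= addn0; ring.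
(* Terms with [m > j] vanish, so any [M > j] will do; this freedom lets column [k.+1] be used with a
   sum one term shorter. *)
elim/ltn_ind: j k M => -[_ k [|M]// _ _|j IHj k [|M]// jk jM].
have jk' := ltnW jk.
have jM' : (j < M.+1)%N by lia.
have e : u j.+1 k = (2 * rho + 1 + (0 < j)%:R) * u j k
    - (0 < j)%:R * (2 * rho * u j.-1 k) - u j k.+1.
  by rewrite (balanced_upper bu jk') ltn_eqF// mulr0n; ring.
have shift (f : nat -> R) : f 0%N = 0 ->
    \sum_(m < M) u 0%N (k.+1 + m)%N * f m.+1 =
    \sum_(m < M.+1) u 0%N (k + m)%N * f m.
  move=> f0; rewrite [RHS]big_ord_recl f0 mulr0 add0r.
  by apply: eq_bigr => m _; rewrite lift0 addSnnS.
rewrite e (IHj j _ k M.+1)// (IHj j _ k.+1 M)//; last by lia.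
case: j IHj jk jM jk' jM' {e} => [|j] IHj jk jM jk' jM'.
  (* The unit [convn _ 0] is nonzero at [0], so the vanishing values at [0] are replaced by [0]
     before [shift] applies. *)
  under [X in _ - X]eq_bigr do rewrite convn_jsq_g0.
  rewrite (shift (fun m => 0 - convn (jsq_g rho) m 1)) ?subr0//.
  rewrite mul0r subr0 mulr_sumr -sumrB; apply: eq_bigr => m _.
  by rewrite convn_jsq_gSS convn_jsq_g0 mulr0n; ring.
rewrite (shift (fun m => convn (jsq_g rho) m j.+1 - convn (jsq_g rho) m j.+2));
  last exact: subr0.
rewrite succnK (IHj j _ k M.+1)//; [|lia..].
rewrite ltn0Sn mulr1n mul1r !mulr_sumr -!sumrB; apply: eq_bigr => m _.
by rewrite (convn_jsq_gSS _ _ j.+1) (convn_jsq_gSS _ _ j); ring.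
Qed.

Theorem theorem4 (R : realType) (rho : R) (pi : nat * nat -> R)
    (rho_gt0 : 0 < rho) (rho_lt1 : rho < 1)
    (pi_inv : invariant_distribution (jsq_rate rho) pi) :
  (forall j k : nat, (j < k)%N ->
     pi (j, k) =
     \sum_(k <= l < 2 * k)
        pi (0%N, l) * (convn (jsq_g rho) (l - k + 1)%N j
                       - convn (jsq_g rho) (l - k + 1)%N j.+1)) /\
  (forall k : nat,
     pi (k, k) =
     - (1 / rho) *
       \sum_(k.+1 <= l < (2 * k).+2)
          pi (0%N, l) * convn (jsq_g rho) (l - k)%N k.+1).
Proof.
have r0 := ltW rho_gt0; have [pi0 pi1 _] := pi_inv.
pose u j k := pi (j, k).
have bu : balanced rho u by move=> j k; exact: jsq_balance r0 pi_inv.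
have usym : forall j k, u j k = u k j.
  (* The diagonal carries at most the total mass [1]. *)
  apply: (balanced_sym (B := 1) r0 bu) => [j k|k n]; first exact: pi0.
  rewrite -lee_fin -pi1.
  rewrite -(big_map (fun i => (i, i)) xpredT pi); apply: sum_le_esum.
  by rewrite map_inj_uniq ?iota_uniq// => i j [].
have shift F a n :
    \sum_(a <= l < a + n) F l = \sum_(m < n) F (a + m)%N :> R.
  rewrite -{1}[a]add0n big_addn addKn big_mkord.
  by apply: eq_bigr => m _; rewrite addnC.
split=> [j k jk|k].
  (* Taking [M = k] gives the range [k <= l < 2 * k]. *)
  rewrite -[pi _]/(u j k) (balanced_solution bu jk jk) mul2n -addnn.
  by rewrite shift; apply: eq_bigr => m _; rewrite addKn addn1.
rewrite div1r mulNr -mulrN; apply: (mulfI (lt0r_neq0 rho_gt0)).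
rewrite mulVKf ?lt0r_neq0//.
have -> : rho * pi (k, k) = \sum_(j < k.+1) u j k.+1.
  have := balanced_cut k bu; rewrite big_split /=.
  under [X in _ + X]eq_bigr do rewrite usym.
  by rewrite -/(u k k); lra.
(* The common bound [M = k.+1] for all [j <= k] allows exchanging the sums; the sum over [j] then
   telescopes. *)
rewrite (eq_bigr (fun j : 'I_k.+1 => \sum_(m < k.+1) u 0%N (k.+1 + m)%N *
   (convn (jsq_g rho) m.+1 j - convn (jsq_g rho) m.+1 j.+1))); last first.
  by move=> j _; exact: balanced_solution.
rewrite exchange_big /= mul2n -addnn -addSn -addnS shift.
rewrite -sumrN; apply: eq_bigr => m _.
have -> : (k.+1 + m - k = m.+1)%N by lia.
rewrite -mulr_sumr -mulrN; congr (_ * _).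
under eq_bigr do rewrite -opprB.
rewrite sumrN -(big_mkord xpredT (fun j => convn (jsq_g rho) m.+1 j.+1
  - convn (jsq_g rho) m.+1 j)) telescope_sumr//.
by rewrite convn_jsq_g0 subr0.
Qed.
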